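(* Let $\mathbb{K}$ be a field, let $G$ be any finite simple graph and suppose $G'$ is obtained from $G$ by attaching a whisker at every vertex of $G$. Then $\mathrm{reg}(R_{G'}/NI(G'))=a_{G'}$ and $\mathrm{pd}(R_{G'}/NI(G'))=a_{G'}$.
   Context: To attach a whisker at a vertex $x$ of a graph means to add a new vertex $y$ together with the single edge $\{x,y\}$; attaching a whisker at every vertex of $G$ with $V(G)=\{x_1,\ldots,x_n\}$ thus gives the graph on $\{x_1,\ldots,x_n,y_1,\ldots,y_n\}$ with edges $E(G)\cup\{\{x_i,y_i\}:1\le i\le n\}$. For a graph $H$, $R_H$ denotes the polynomial ring over $\mathbb{K}$ whose variables are the vertices of $H$ (standard grading, each variable of degree 1). For $w\in V(H)$, $N_H[w]$ is the closed neighborhood of $w$ ($w$ together with all vertices adjacent to $w$) and $m_{(H,w)}=\prod_{z\in N_H[w]}z\in R_H$. The closed neighborhood ideal is $NI(H)=\langle m_{(H,w)} : w\in V(H)\rangle\subseteq R_H$. A matching of $H$ is a set of pairwise disjoint edges; the matching number $a_H$ is the maximum size of a matching. With $\beta_{i,j}$ denoting graded Betti numbers over $R_H$, $\mathrm{reg}(R_H/I)=\max\{j-i:\beta_{i,j}(R_H/I)\neq 0\}$ is the Castelnuovo-Mumford regularity and $\mathrm{pd}(R_H/I)=\max\{i:\beta_{i,j}(R_H/I)\ne 0\text{ for some }j\}$ is the projective dimension. *)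

(* Defs.v *)
From HB Require Import structures.
From mathcomp Require Import all_boot all_order all_algebra.
From mathcomp Require Export mpoly.
From Stdlib Require ClassicalEpsilon.

Set Implicit Arguments.
Unset Strict Implicit.
Unset Printing Implicit Defensive.

Import GRing.Theory.
Local Open Scope ring_scope.

Record sgraph := SGraph {
  vertex :> finType;
  adj : rel vertex;
  adj_sym : ssrbool.symmetric adj;
  adj_irrefl : irreflexive adj }.

Definition edges (H : sgraph) : {set {set H}} :=
  [set [set x; y] | x in H, y in H & adj x y].

Definition matching (H : sgraph) (M : {set {set H}}) : bool :=
  (M \subset edges H) && trivIset M.

Definition matching_number (H : sgraph) : nat :=
  (\max_(M : {set {set H}} | matching M) #|M|)%N.

(* [inl x] is the original vertex x, [inr x] the whisker vertex at x. *)
Definition whisker_adj (G : sgraph) : rel (G + G)%type :=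
  fun u v => match u, v with
             | inl x, inl y => adj x y
             | inl x, inr y => x == y
             | inr x, inl y => x == y
             | inr _, inr _ => false
             end.

Fact whisker_sym G : ssrbool.symmetric (@whisker_adj G).
Proof. by case=> x [] y //=; rewrite ?(adj_sym x y) // eq_sym. Qed.

Fact whisker_irrefl G : irreflexive (@whisker_adj G).
Proof. by case=> x //=; rewrite adj_irrefl. Qed.

Definition whiskered (G : sgraph) : sgraph :=
  SGraph (@whisker_sym G) (@whisker_irrefl G).

Definition closed_nbhd (H : sgraph) (w : H) : {set H} :=
  [set z | (z == w) || adj w z].

(* R_H is {mpoly K[#|H|]}; the variable of a vertex z is 'X_(enum_rank z). *)
Definition nbhd_monomial (K : fieldType) (H : sgraph) (w : H) :
    {mpoly K[#|H|]} :=
  \prod_(z in closed_nbhd w) 'X_(enum_rank z).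

Definition ideal_gen (R : comNzRingType) (J : finType) (g : J -> R) : R -> Prop :=
  fun p => exists c : J -> R, p = \sum_(j : J) c j * g j.

Definition NI (K : fieldType) (H : sgraph) : {mpoly K[#|H|]} -> Prop :=
  ideal_gen (@nbhd_monomial K H).

Section Resolutions.

Variables (K : fieldType) (n : nat).
Local Notation R := {mpoly K[n]}.

(* A matrix acts on row vectors from the right; as a map
   (+)_k R(- r k) -> (+)_l R(- s l) it is graded of degree 0. *)
Definition graded_mx p q (r : 'I_p -> int) (s : 'I_q -> int) (A : 'M[R]_(p, q)) :=
  forall k l (m : 'X_{1..n}), m \in msupp (A k l) -> (mdeg m)%:Z + s l = r k.

(* F_i = (+)_(k < res_rank i) R(- res_shift i k),
   res_diff i : F_(i+1) -> F_i, and res_aug : F_0 -> R lifts F_0 -> R/I. *)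
Record free_resolution_data := FreeResolutionData {
  res_rank : nat -> nat;
  res_shift : forall i, 'I_(res_rank i) -> int;
  res_diff : forall i, 'M[R]_(res_rank i.+1, res_rank i);
  res_aug : 'cV[R]_(res_rank 0) }.

Definition graded_free_resolution (I : R -> Prop) (F : free_resolution_data) :=
  [/\ forall i, graded_mx (@res_shift F i.+1) (@res_shift F i) (res_diff F i),
      graded_mx (@res_shift F 0) (fun=> 0) (res_aug F),
      forall p : R, exists v : 'rV_(res_rank F 0), I (p - (v *m res_aug F) 0 0),
      forall v : 'rV_(res_rank F 0), I ((v *m res_aug F) 0 0) <->
        exists w : 'rV_(res_rank F 1), v = w *m res_diff F 0
    & forall i (v : 'rV_(res_rank F i.+1)), v *m res_diff F i = 0 <->
        exists w : 'rV_(res_rank F i.+2), v = w *m res_diff F i.+1].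

(* The image of F_(i+1) lies in (x_1, ..., x_n) F_i. *)
Definition minimal_resolution (F : free_resolution_data) :=
  forall i k l, (res_diff F i k l)@_0%MM = 0.

(* beta_(i,j)(R/I): the number of summands R(-j) in F_i, for F a minimal
   graded free resolution of R/I.  It does not depend on F; the value is
   unspecified when there is no such F, i.e. when I is not homogeneous. *)
Definition betti (I : R -> Prop) (i : nat) (j : int) : nat :=
  ClassicalEpsilon.epsilon (inhabits 0%N) (fun b : nat =>
    exists F, [/\ graded_free_resolution I F, minimal_resolution F
                & b = #|[set k | @res_shift F i k == j]|]).

Definition is_max (d : Order.disp_t) (T : porderType d) (P : T -> Prop) (m : T) :=
  P m /\ forall x, P x -> (x <= m)%O.

Definition is_regularity (I : R -> Prop) (r : int) :=
  is_max (fun s : int => exists i j, betti I i j <> 0%N /\ s = j - i%:Z) r.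

Definition is_proj_dim (I : R -> Prop) (d : nat) :=
  is_max (fun i : nat => exists j, betti I i j <> 0%N) d.

End Resolutions.

(* Main.v *)
(** In [G'] the closed neighborhood of [x_a] contains that of the whisker vertex
    [y_a], which is [{x_a, y_a}], so [NI(G')] is generated by the [x_a y_a], a
    regular sequence of [#|G|] quadrics.  Its Koszul complex, obtained by taking
    mapping cones of multiplication by one [x_a y_a] at a time, is a minimal
    resolution with [F_i = R(-2i)^C(#|G|, i)].  Since minimal graded resolutions
    of the same module have the same shifts, the Betti numbers are known, and
    regularity and projective dimension both equal [#|G|].  The whiskers form a
    perfect matching of [G'], so this is also the matching number. *)

Require Import Defs.
From mathcomp Require Import all_boot all_order all_algebra.
From mathcomp Require Import ring zify.
From Stdlib Require ClassicalEpsilon.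

Set Implicit Arguments.
Unset Strict Implicit.
Unset Printing Implicit Defensive.

Import GRing.Theory.
Local Open Scope ring_scope.

(** Free modules are projective: lifting the images of the basis vectors is enough to lift the whole
    map. *)
Lemma row_lift (R : comNzRingType) p q r (A : 'M[R]_(p, q)) (D : 'M_(r, q)) :
  (forall k, exists w : 'rV_r, row k A = w *m D) -> exists W, A = W *m D.
Proof.
move=> /fin_all_exists[w wP]; exists (\matrix_k w k).
by apply/row_matrixP => k; rewrite row_mul rowK.
Qed.

(** * Homogeneous components and graded parts of matrices *)

Section HomogeneousComponent.

Variables (K : fieldType) (n : nat).
Local Notation R := {mpoly K[n]}.

Definition msupp_filter (P : pred 'X_{1..n}) (p : R) : R :=
  \sum_(m <- msupp p | P m) p@_m *: 'X_[m].

Lemma mcoeff_msupp_filter P p m :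
  (msupp_filter P p)@_m = if P m then p@_m else 0.
Proof.
rewrite raddf_sum /=; under eq_bigr do rewrite mcoeffZ mcoeffX.
have [mp|/memN_msupp_eq0 p0] := boolP (m \in msupp p); last first.
  rewrite p0 if_same big1_seq // => k _.
  by case: eqP => [->|_]; rewrite ?p0 ?mul0r ?mulr0.
rewrite big_mkcond (bigD1_seq m) ?msupp_uniq //= eqxx mulr1 big1 ?addr0 //.
by move=> k /negPf ->; rewrite mulr0 if_same.
Qed.

(* Degrees are integers because so are the shifts of a graded free module; the
   components of negative degree are zero. *)
Definition homog_comp (z : int) : R -> R := msupp_filter (fun m => (mdeg m)%:Z == z).

Lemma mcoeff_homog_comp z p m :
  (homog_comp z p)@_m = if (mdeg m)%:Z == z then p@_m else 0.
Proof. exact: mcoeff_msupp_filter. Qed.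

Lemma homog_compM z (e : int) p q :
  (forall m, m \in msupp q -> (mdeg m)%:Z = e) ->
  homog_comp z (p * q) = homog_comp (z - e) p * q.
Proof.
move=> qe; apply/mpolyP => m; rewrite mcoeff_homog_comp !mcoeffM.
have -> : (if (mdeg m)%:Z == z then
   \sum_(k : 'X_{1..n < (mdeg m).+1, (mdeg m).+1} | m == (k.1 + k.2)%MM)
     p@_k.1 * q@_k.2 else 0)
  = \sum_(k : 'X_{1..n < (mdeg m).+1, (mdeg m).+1} | m == (k.1 + k.2)%MM)
     if (mdeg m)%:Z == z then p@_k.1 * q@_k.2 else 0.
  by case: eqP => // _; rewrite big1.
apply: eq_bigr => k /eqP mE; rewrite mcoeff_homog_comp.
have [kq|/memN_msupp_eq0 ->] := boolP (bmnm k.2 \in msupp q); last first.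
  by rewrite !mulr0 if_same.
have -> : (mdeg m)%:Z = (mdeg k.1)%:Z + e.
  by rewrite -(qe _ kq) -PoszD -mdegD; congr (Posz (mdeg _)).
rewrite (can2_eq (addrK _) (subrK _)).
by case: eqP => _; rewrite ?mul0r.
Qed.

Lemma homog_compB z : {morph homog_comp z : p q / p - q}.
Proof.
move=> p q; apply/mpolyP => m; rewrite mcoeffB !mcoeff_homog_comp mcoeffB.
by case: ifP => _; rewrite ?subrr.
Qed.

(** The degree 0 part of a map of graded free modules; it turns an arbitrary lift into a graded
    one. *)
Definition graded_part p q (r : 'I_p -> int) (s : 'I_q -> int) (A : 'M[R]_(p, q))
  : 'M_(p, q) := \matrix_(k, l) homog_comp (r k - s l) (A k l).

Lemma graded_part_graded p q r s (A : 'M_(p, q)) :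
  graded_mx r s (graded_part r s A).
Proof.
move=> k l m; rewrite mxE mcoeff_msupp mcoeff_homog_comp.
by case: ifP => [/eqP ->|]; rewrite ?subrK ?eqxx.
Qed.

Lemma graded_part_id p q r s (A : 'M_(p, q)) :
  graded_mx r s A -> graded_part r s A = A.
Proof.
move=> gA; apply/matrixP => k l; rewrite mxE; apply/mpolyP => m.
rewrite mcoeff_homog_comp.
have [/gA <-|/memN_msupp_eq0 ->] := boolP (m \in msupp (A k l)); last first.
  by rewrite if_same.
by rewrite addrK eqxx.
Qed.

(** Multiplication by the entry [B i l], homogeneous of degree [s i - u l], shifts all degrees by
    that amount, so it commutes with taking components. *)
Lemma graded_part_mulmx p q t r s u (A : 'M_(p, q)) (B : 'M_(q, t)) :
  graded_mx s u B -> graded_part r u (A *m B) = graded_part r s A *m B.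
Proof.
move=> gB; apply/matrixP => k l; rewrite !mxE; apply/mpolyP => m.
rewrite mcoeff_homog_comp !(raddf_sum (mcoeff m)) /=.
have -> (b : bool) (F : 'I_q -> K) :
    (if b then \sum_i F i else 0) = \sum_i if b then F i else 0.
  by case: b => //; rewrite big1.
apply: eq_bigr => i _; rewrite mxE.
rewrite -(_ : r k - u l - (s i - u l) = r k - s i); last by ring.
rewrite -homog_compM ?mcoeff_homog_comp // => m' /gB <-.
by rewrite addrK.
Qed.

Definition is_ideal (I : R -> Prop) :=
  [/\ I 0, forall p q, I p -> I q -> I (p + q) & forall p q, I q -> I (p * q)].

Definition homogeneous (I : R -> Prop) := forall z p, I p -> I (homog_comp z p).

Lemma ideal_mulmx (I : R -> Prop) p q (A : 'M_(p, q)) (v : 'cV_q) :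
  is_ideal I -> (forall k, I (v k 0)) -> forall k, I ((A *m v) k 0).
Proof.
by move=> [I0 ID IM] Iv k; rewrite mxE; elim/big_ind: _ => // l _; apply: IM.
Qed.

Lemma idealN (I : R -> Prop) p : is_ideal I -> I p -> I (- p).
Proof. by case=> _ _ IM Ip; rewrite -mulN1r; apply: IM. Qed.

End HomogeneousComponent.

(** * Independence of the graded Betti numbers from the minimal resolution *)

Section BettiUniqueness.

Variables (K : fieldType) (n : nat) (I : {mpoly K[n]} -> Prop).
Local Notation R := {mpoly K[n]}.
Hypotheses (idI : is_ideal I) (homI : homogeneous I).

Local Notation data := (free_resolution_data K n).
Local Notation resolution := (@graded_free_resolution K n I).

(** The identity of [R/I] is lifted on basis vectors; homogeneity of [I] keeps the congruence valid
    after passing to the graded part. *)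
Lemma aug_lift (F G : data) : resolution F -> resolution G ->
  exists2 f : 'M[R]_(res_rank F 0, res_rank G 0),
    graded_mx (@res_shift _ _ F 0) (@res_shift _ _ G 0) f
    & forall k, I ((f *m res_aug G - res_aug F) k 0).
Proof.
move=> [_ gF _ _ _] [_ gG surjG _ _].
have /fin_all_exists[w wP] k := surjG (res_aug F k 0).
exists (graded_part (@res_shift _ _ F 0) (@res_shift _ _ G 0) (\matrix_k w k)).
  exact: graded_part_graded.
move=> k; rewrite -(graded_part_mulmx _ _ gG) -(graded_part_id gF).
have := homI (res_shift k - 0) (idealN idI (wP k)).
rewrite opprB homog_compB !mxE; congr (I (homog_comp _ _ - _)).
by apply: eq_bigr => l _; rewrite mxE.
Qed.

(** One step of the comparison theorem. Assuming that [f] sends boundaries to boundaries treats the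
    step next to the augmentation and the later ones alike. *)
Lemma diff_lift (F G : data) i : resolution F -> resolution G ->
  forall f : 'M[R]_(res_rank F i, res_rank G i),
  graded_mx (@res_shift _ _ F i) (@res_shift _ _ G i) f ->
  (forall w : 'rV_(_), exists w' : 'rV_(_), w *m res_diff F i *m f = w' *m res_diff G i) ->
  exists2 f', graded_mx (@res_shift _ _ F i.+1) (@res_shift _ _ G i.+1) f'
    & f' *m res_diff G i = res_diff F i *m f.
Proof.
move=> [gF _ _ _ _] [gG _ _ _ _] f gf bf.
have [k|W WP] := @row_lift _ _ _ _ (res_diff F i *m f) (res_diff G i).
  by have [w'] := bf (delta_mx 0 k); rewrite -mulmxA -rowE; exists w'.
exists (graded_part (@res_shift _ _ F i.+1) (@res_shift _ _ G i.+1) W).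
  exact: graded_part_graded.
by rewrite -(graded_part_mulmx _ _ (gG i)) -WP (graded_part_mulmx _ _ gf) graded_part_id.
Qed.

Lemma diff_diff (F : data) i : resolution F -> res_diff F i.+1 *m res_diff F i = 0.
Proof.
move=> [_ _ _ _ ex]; apply/row_matrixP => k; rewrite row_mul row0.
by apply/ex; exists (delta_mx 0 k); rewrite -rowE.
Qed.

Lemma diff_aug (F : data) : resolution F ->
  forall k, I ((res_diff F 0 *m res_aug F) k 0).
Proof.
move=> [_ _ _ ex _] k.
have -> : (res_diff F 0 *m res_aug F) k 0 = (row k (res_diff F 0) *m res_aug F) 0 0.
  by rewrite -row_mul [RHS]mxE.
by apply/ex; exists (delta_mx 0 k); rewrite -rowE.
Qed.

Lemma im_diffS (F : data) i p (A : 'M[R]_(p, _)) : resolution F ->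
  A *m res_diff F i = 0 -> exists W, A = W *m res_diff F i.+1.
Proof.
move=> [_ _ _ _ ex] A0; apply: row_lift => k; apply/ex.
by rewrite -row_mul A0 row0.
Qed.

Lemma im_diff0 (F : data) p (A : 'M[R]_(p, _)) : resolution F ->
  (forall k, I ((A *m res_aug F) k 0)) -> exists W, A = W *m res_diff F 0.
Proof.
move=> [_ _ _ ex _] A0; apply: row_lift => k; apply/ex.
by rewrite -row_mul mxE.
Qed.

Definition const_mx0 p q (A : 'M[R]_(p, q)) : 'M[K]_(p, q) := map_mx (mcoeff 0%MM) A.

(* Compares F with itself through G: [f *m g] is homotopic to the identity via
   some [h], and the homotopy vanishes modulo the variables as F is minimal. *)
Lemma comparison (F G : data) i : resolution F -> resolution G ->
  minimal_resolution F ->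
  exists f : 'M[R]_(res_rank F i, res_rank G i),
  exists g : 'M[R]_(res_rank G i, res_rank F i),
  [/\ graded_mx (@res_shift _ _ F i) (@res_shift _ _ G i) f,
      graded_mx (@res_shift _ _ G i) (@res_shift _ _ F i) g
    & const_mx0 (f *m g) = 1%:M].
Proof.
move=> resF resG minF.
have const_diff j : const_mx0 (res_diff F j) = 0.
  by apply/matrixP => k l; rewrite !mxE; apply: minF.
(* The induction also carries what [diff_lift] needs, and a homotopy [h] from [F_i] to [F_(i+1)].
   The other homotopy term factors through the differential leaving [F_i], so it dies on boundaries;
   stating only this avoids the index [i - 1]. *)
suff [f [g [gf gg [_ _ [h [_ fg1]]]]]] :
  exists f : 'M[R]_(res_rank F i, res_rank G i),
  exists g : 'M[R]_(res_rank G i, res_rank F i),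
  [/\ graded_mx (@res_shift _ _ F i) (@res_shift _ _ G i) f,
      graded_mx (@res_shift _ _ G i) (@res_shift _ _ F i) g
    & [/\ forall w : 'rV_(_), exists w' : 'rV_(_), w *m res_diff F i *m f = w' *m res_diff G i,
      forall w : 'rV_(_), exists w' : 'rV_(_), w *m res_diff G i *m g = w' *m res_diff F i
    & exists h, res_diff F i *m (f *m g - 1%:M - h *m res_diff F i) = 0
      /\ const_mx0 (f *m g) = 1%:M]].
  by exists f, g.
elim: i => [|i [f [g [gf gg [bf bg [h [fgh _]]]]]]].
  have [f gf fP] := aug_lift resF resG; have [g gg gP] := aug_lift resG resF.
  have bd (F1 F2 : data) (f1 : 'M_(res_rank F1 0, res_rank F2 0)) :
      resolution F1 -> resolution F2 ->
      (forall k, I ((f1 *m res_aug F2 - res_aug F1) k 0)) ->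
      forall w : 'rV_(res_rank F1 1),
        exists w' : 'rV_(res_rank F2 1), w *m res_diff F1 0 *m f1 = w' *m res_diff F2 0.
    move=> res1 res2 f1P w; apply: im_diff0 => // k.
    rewrite -mulmxA -[f1 *m _](subrK (res_aug F1)) mulmxDr mxE.
    case: (idI) => _ ID _; apply: ID; first exact: ideal_mulmx.
    by rewrite -mulmxA; apply: ideal_mulmx => //; apply: diff_aug.
  have [k|h hP] := @im_diff0 F _ (f *m g - 1%:M) resF.
    rewrite mulmxBl mul1mx -mulmxA -[g *m _](subrK (res_aug G)) mulmxDr.
    rewrite -addrA mxE; case: (idI) => _ ID _; apply: ID => //.
    exact: ideal_mulmx.
  exists f, g; split => //; split; [exact: bd | exact: bd |].
  exists h; rewrite hP subrr mulmx0; split=> //.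
  rewrite -[f *m g](subrK 1%:M) hP /const_mx0 map_mxD map_mxM /=.
  by rewrite [map_mx _ (res_diff F 0)]const_diff mulmx0 add0r map_mx1.
have [f' gf' fP] := diff_lift resF resG gf bf.
have [g' gg' gP] := diff_lift resG resF gg bg.
have bd (F1 F2 : data) (f1 : 'M_(res_rank F1 i, res_rank F2 i)) f2 :
    resolution F1 -> resolution F2 ->
    f2 *m res_diff F2 i = res_diff F1 i *m f1 ->
    forall w : 'rV_(res_rank F1 i.+2), exists w' : 'rV_(res_rank F2 i.+2),
      w *m res_diff F1 i.+1 *m f2 = w' *m res_diff F2 i.+1.
  move=> res1 res2 fP' w; apply: im_diffS => //.
  by rewrite -mulmxA fP' mulmxA -[_ *m _ *m res_diff F1 i]mulmxA diff_diff // mulmx0 mul0mx.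
(* As [f'] and [g'] commute with the differentials, composing this matrix with [res_diff F i] gives
   the expression that the induction hypothesis [fgh] makes zero; exactness then yields the next
   homotopy. *)
have [|h' hP] := @im_diffS F i _ (f' *m g' - 1%:M - res_diff F i *m h) resF.
  by rewrite !mulmxBl mul1mx -mulmxA gP mulmxA fP -!mulmxA -{2}[res_diff F i]mulmx1
    -!mulmxBr.
exists f', g'; split => //; split; [exact: bd fP | exact: bd gP |].
exists h'; split.
  by rewrite -hP opprB addrCA subrr addr0 mulmxA diff_diff // mul0mx.
rewrite -[f' *m g'](subrK 1%:M) -[_ - 1%:M](subrK (res_diff F i *m h)) hP.
rewrite /const_mx0 !map_mxD !map_mxM /= map_mx1.
by rewrite ![map_mx _ (res_diff F _)]const_diff mulmx0 mul0mx !add0r.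
Qed.

(** Modulo the variables, graded maps respect the decomposition by shifts, so the identity of the
    shift [j] part of [F_i] factors through that of [G_i], a space over [K] of dimension [#|T|]. *)
Lemma leq_shift_count (F G : data) i j : resolution F -> resolution G ->
  minimal_resolution F ->
  (#|[set k | @res_shift _ _ F i k == j]| <= #|[set k | @res_shift _ _ G i k == j]|)%N.
Proof.
move=> resF resG minF; have [f [g [gf gg fg1]]] := comparison i resF resG minF.
set S := [set k | @res_shift _ _ F i k == j]; set T := [set l | @res_shift _ _ G i l == j].
pose A : 'M[K]_(#|S|, #|T|) := \matrix_(a, b) const_mx0 f (enum_val a) (enum_val b).
pose B : 'M[K]_(#|T|, #|S|) := \matrix_(b, a) const_mx0 g (enum_val b) (enum_val a).
apply: (@mulmx1_min K _ _ A B); apply/matrixP => a b; rewrite !mxE.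
transitivity ((1%:M : 'M[K]_(res_rank F i)) (enum_val a) (enum_val b)); last first.
  by rewrite mxE (inj_eq enum_val_inj).
rewrite -fg1 /const_mx0 map_mxM /= mxE.
pose E l := const_mx0 f (enum_val a) l * const_mx0 g l (enum_val b).
(* A nonzero constant entry of the graded matrix [f] joins equal shifts, so indices outside [T]
   contribute nothing. *)
rewrite (bigID (mem T)) /= [X in _ + X]big1 => [|l lT]; last first.
  rewrite [X in X * _](_ : _ = 0) ?mul0r // mxE; apply: memN_msupp_eq0.
  apply: contra lT => /gf; rewrite mdeg0 add0r inE => ->.
  by have := enum_valP a; rewrite inE.
rewrite addr0 (big_enum_val E).
by apply: eq_bigr => l _; rewrite /E !mxE.
Qed.

Lemma betti_eq (F : data) i j : resolution F -> minimal_resolution F ->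
  betti I i j = #|[set k | @res_shift _ _ F i k == j]|.
Proof.
move=> resF minF; rewrite /betti; set P := (X in ClassicalEpsilon.epsilon _ X).
have [|G [resG minG ->]] := ClassicalEpsilon.epsilon_spec (inhabits 0%N) P.
  by exists #|[set k | @res_shift _ _ F i k == j]|, F.
apply/eqP; rewrite eqn_leq; apply/andP; split; apply: leq_shift_count => //.
Qed.

End BettiUniqueness.

(** * The mapping cone of multiplication by a regular element *)

Section MappingCone.

Variables (K : fieldType) (n : nat).
Local Notation R := {mpoly K[n]}.
Variables (F : free_resolution_data K n) (f : R) (d : int).

Definition cone_rank i :=
  if i is i'.+1 then (res_rank F i'.+1 + res_rank F i')%N else res_rank F 0.

Definition cone_shift i : 'I_(cone_rank i) -> int :=
  match i with
  | 0 => @res_shift _ _ F 0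
  | i'.+1 => fun k => match split k with
                      | inl a => @res_shift _ _ F i'.+1 a
                      | inr b => @res_shift _ _ F i' b + d
                      end
  end.

(** On [F_(i+1) (+) F_i(-d)] this is the map [(a, b) |-> (a d + f b, - b d)], where [d] in the
    formula stands for the differential of [F]; the sign makes the square zero. For [i = 0] the
    second component is absent. *)
Definition cone_diff i : 'M[R]_(cone_rank i.+1, cone_rank i) :=
  match i with
  | 0 => col_mx (res_diff F 0) f%:M
  | i'.+1 => block_mx (res_diff F i'.+1) 0 f%:M (- res_diff F i')
  end.

Definition cone := FreeResolutionData cone_shift cone_diff (res_aug F).

Lemma msupp_scalar p (k l : 'I_p) m :
  m \in msupp ((f%:M : 'M[R]_p) k l) -> m \in msupp f /\ k = l.
Proof.
rewrite mxE !mcoeff_msupp; case: (k =P l) => [-> //|_].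
by rewrite mulr0n mcoeff0 eqxx.
Qed.

Lemma cone_graded i : (forall m, m \in msupp f -> (mdeg m)%:Z = d) ->
  (forall j, graded_mx (@res_shift _ _ F j.+1) (@res_shift _ _ F j) (res_diff F j)) ->
  graded_mx (@cone_shift i.+1) (@cone_shift i) (cone_diff i).
Proof.
move=> fd gF; case: i => [|i] k l m; rewrite /= mxE; case: split => a.
- exact: gF.
- by case/msupp_scalar => /fd -> ->; rewrite addrC.
- rewrite mxE; case: split => b; first exact: gF.
  by rewrite mxE mcoeff_msupp mcoeff0 eqxx.
rewrite mxE; case: split => b; first by case/msupp_scalar => /fd -> ->; rewrite addrC.
by rewrite mxE (perm_mem (msuppN _)) addrA => /gF ->.
Qed.

Lemma cone_minimal : f@_0%MM = 0 -> minimal_resolution F -> minimal_resolution cone.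
Proof.
move=> f0 minF [|i] k l; rewrite /= mxE; case: split => a.
- exact: minF.
- by rewrite mxE mcoeffMn f0 mul0rn.
- by rewrite mxE; case: split => b; [apply: minF | rewrite mxE mcoeff0].
rewrite mxE; case: split => b; first by rewrite mxE mcoeffMn f0 mul0rn.
by rewrite mxE mcoeffN minF oppr0.
Qed.

Variables (I J : R -> Prop).
Hypotheses (idI : is_ideal I) (JE : forall p, J p <-> exists q, I (p - q * f)).
Hypothesis f_regular : forall p, I (p * f) -> I p.
Hypothesis f_homog : forall m, m \in msupp f -> (mdeg m)%:Z = d.

(** Here [J] is [I + (f)] and [f] is a nonzerodivisor modulo [I]. In a cycle [(a, b)] the component
    [b] is a boundary, in homological degree 1 by regularity of [f] and above it by exactness of
    [F]; then [a] is corrected by a multiple of [f]. *)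
Lemma cone_resolution : graded_free_resolution I F -> graded_free_resolution J cone.
Proof.
move=> resF; have [gF gaugF surjF ex0 exF] := resF.
have [I0 ID IM] := idI.
have dd i p (A : 'M_(p, _)) : A *m res_diff F i.+1 *m res_diff F i = 0.
  by rewrite -mulmxA (diff_diff _ resF) mulmx0.
split => //.
- by move=> i; apply: cone_graded.
- by move=> p; have [v vP] := surjF p; exists v; apply/JE; exists 0; rewrite mul0r subr0.
- move=> v; rewrite JE /=; split.
    (* Subtracting [f] times a lift [b] of [q] moves the augmentation of [v] from [J] into [I]. *)
    move=> [q Iq]; have [b Ib] := surjF q.
    have [|a aP] := (ex0 (v - f *: b)).1.
      rewrite mulmxBl -scalemxAl mxE [X in _ + X]mxE [X in _ - X]mxE.
      by have := ID _ _ Iq (IM f _ Ib); rewrite mulrBr [f * q]mulrC addrA subrK.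
    exists (row_mx a b); rewrite mul_row_col mul_mx_scalar -aP.
    by rewrite subrK.
  move=> [w ->]; rewrite -[w]hsubmxK mul_row_col mul_mx_scalar.
  exists ((rsubmx w *m res_aug F) 0 0).
  rewrite mulmxDl -scalemxAl mxE [X in _ + X - _]mxE mulrC addrK.
  by apply/ex0; exists (lsubmx w).
case=> [|i] v; rewrite -[v]hsubmxK; set a := lsubmx v; set b := rsubmx v.
  rewrite /= mul_row_col mul_mx_scalar; split.
    move=> ab0; have [|b' b'P] := (ex0 b).1.
      apply: f_regular; have /eqP := ab0; rewrite addrC addr_eq0 => /eqP fb.
      have := congr1 (fun u => (u *m res_aug F) 0 0) fb.
      rewrite -scalemxAl mulNmx !mxE [f * _]mulrC => ->.
      have -> : \sum_j (a *m res_diff F 0) 0 j * res_aug F j 0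
                = (a *m res_diff F 0 *m res_aug F) 0 0 by rewrite [RHS]mxE.
      by apply: idealN => //; apply/ex0; exists a.
    have [|a' a'P] := (exF 0%N (a + f *: b')).1.
      by rewrite mulmxDl -scalemxAl -b'P.
    (* The sign of [b'] cancels the sign in the cone differential, and its image under [f] removes
       the correction [f *: b'] from [a]. *)
    exists (row_mx a' (- b')); rewrite mul_row_block mulmx0 add0r mul_mx_scalar.
    by rewrite mulmxN mulNmx opprK -b'P -a'P scalerN addrK.
  move=> [w]; rewrite -[w]hsubmxK mul_row_block mulmx0 add0r mul_mx_scalar.
  move=> /eq_row_mx[-> ->]; rewrite mulmxDl dd add0r -scalemxAl mulmxN.
  by rewrite scalerN subrr.
rewrite /= mul_row_block mulmx0 add0r mul_mx_scalar mulmxN; split.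
  rewrite -(row_mx0 R 1) => /eq_row_mx[ab0 /eqP]; rewrite oppr_eq0 => /eqP/exF[b' b'P].
  have [|a' a'P] := (exF i.+1 (a + f *: b')).1.
    by rewrite mulmxDl -scalemxAl -b'P.
  exists (row_mx a' (- b')); rewrite mul_row_block mulmx0 add0r mul_mx_scalar.
  by rewrite mulmxN mulNmx opprK -b'P -a'P scalerN addrK.
move=> [w]; rewrite -[w]hsubmxK mul_row_block mulmx0 add0r mul_mx_scalar.
move=> /eq_row_mx[-> ->]; rewrite mulmxDl dd add0r -scalemxAl mulmxN.
by rewrite mulNmx dd oppr0 scalerN subrr oppr0 row_mx0.
Qed.

End MappingCone.

(** * The Koszul resolution for the quadrics [x_a y_a] *)

Section KoszulResolution.

Variables (K : fieldType) (n : nat) (T : eqType) (x y : T -> 'I_n).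
Hypotheses (x_inj : injective x) (y_inj : injective y).
Hypothesis xy_neq : forall a b, x a != y b.
Local Notation R := {mpoly K[n]}.

Definition pair_mnm a : 'X_{1..n} := (U_(x a) + U_(y a))%MM.

(** The monomial ideal generated by the [x_a y_a] with [a] in [s], described by supports so that
    membership is a divisibility test on each monomial. *)
Definition pair_ideal (s : seq T) (p : R) :=
  forall m, m \in msupp p -> has (fun a => (pair_mnm a <= m)%MM) s.

Lemma pair_ideal_ideal s : is_ideal (pair_ideal s).
Proof.
split=> [m|p q Ip Iq m /msuppD_le|p q Iq m /msuppM_le].
- by rewrite mcoeff_msupp mcoeff0 eqxx.
- by rewrite mem_cat => /orP[/Ip|/Iq].
case/allpairsP => -[k1 k2] /= [_ /Iq /hasP[a sa ak2] ->].
by apply/hasP; exists a => //; apply: lepm_trans ak2 (lem_addl _ _).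
Qed.

Lemma pair_ideal_homogeneous s : homogeneous (pair_ideal s).
Proof.
move=> z p Ip m; rewrite mcoeff_msupp mcoeff_homog_comp.
by case: ifP => _; [rewrite -mcoeff_msupp => /Ip | rewrite eqxx].
Qed.

Lemma pair_ideal_cons a s p :
  pair_ideal (a :: s) p <-> exists q, pair_ideal s (p - q * 'X_[pair_mnm a]).
Proof.
split=> [Ip|[q Iq] m].
  (* The quotient by [x_a y_a] of the part of [p] whose monomials it divides; the monomials left
     over must be divisible by a generator from [s]. *)
  exists (\sum_(m <- msupp p | (pair_mnm a <= m)%MM) p@_m *: 'X_[m - pair_mnm a]).
  have -> : (\sum_(m <- msupp p | (pair_mnm a <= m)%MM) p@_m *: 'X_[m - pair_mnm a])
     * 'X_[pair_mnm a] = msupp_filter (fun m => (pair_mnm a <= m)%MM) p.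
    rewrite mulr_suml; apply: eq_bigr => m am.
    by rewrite -scalerAl -mpolyXD submK.
  move=> m; rewrite mcoeff_msupp mcoeffB mcoeff_msupp_filter.
  case: ifPn => [_|am]; first by rewrite subrr eqxx.
  by rewrite subr0 -mcoeff_msupp => /Ip /=; rewrite (negPf am).
rewrite -(subrK (q * 'X_[pair_mnm a]) p) => /msuppD_le; rewrite mem_cat.
case/orP => [/Iq /= ->|]; first by rewrite orbT.
by case/msuppM_le/allpairsP => -[k1 k2] /= [_]; rewrite msuppX inE
  => /eqP-> ->; rewrite lem_addl.
Qed.

Lemma pair_mnm_coprime a b i : a != b -> pair_mnm a i = 0%N \/ pair_mnm b i = 0%N.
Proof.
move=> ab; rewrite !mnmDE !mnm1E.
have [<-|_] := eqVneq (x a) i.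
  by right; rewrite (inj_eq x_inj) eq_sym (negPf ab) eq_sym (negPf (xy_neq _ _)).
have [<-|_] := eqVneq (y a) i; last by left.
by right; rewrite (inj_eq y_inj) (negPf (xy_neq _ _)) eq_sym (negPf ab).
Qed.

(** Multiplying by a monomial translates the support without cancellation, and a generator [x_b y_b]
    with [b] other than [a] that divides [x_a y_a m] divides [m] by coprimality. *)
Lemma pair_ideal_regular a s p : a \notin s ->
  pair_ideal s (p * 'X_[pair_mnm a]) -> pair_ideal s p.
Proof.
move=> sa Ip m mp; have : (pair_mnm a + m)%MM \in msupp (p * 'X_[pair_mnm a]).
  by rewrite mcoeff_msupp mcoeffMX -mcoeff_msupp.
case/Ip/hasP => b sb bam; apply/hasP; exists b => //.
have ab : a != b by apply: contraNneq sa => ->.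
apply/mnm_lepP => i; have := mnm_lepP bam i; rewrite mnmDE.
by have [->|->] := pair_mnm_coprime i ab.
Qed.

(** Each new generator adds one cone, whose ranks follow Pascal's rule. [I] is given up to
    equivalence, as predicates with the same members need not be equal. *)
Lemma koszul_resolution s : uniq s -> forall I : R -> Prop,
  (forall p, I p <-> pair_ideal s p) ->
  exists F, [/\ graded_free_resolution I F, minimal_resolution F,
    forall i, res_rank F i = 'C(size s, i)
    & forall i k, @res_shift _ _ F i k = (2 * i)%:Z].
Proof.
elim: s => [_|a s IHs /= /andP[sa us]] I IE.
  (* For the zero ideal the resolution is [R] in degree 0: the boolean [i == 0%N], read as a number,
     is the rank. *)
  exists (@FreeResolutionData K n (fun i => i == 0%N) (fun _ _ => 0) (fun i => 0)
    (const_mx 1)); split => //=; last by case=> [|i] [].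
  - split => /=.
    + by move=> i [].
    + move=> k l m; rewrite mxE msupp1 inE => /eqP->.
      by rewrite mdeg0.
    + move=> p; exists (const_mx p); apply/IE => m.
      by rewrite mxE big_ord1 !mxE mulr1 subrr mcoeff_msupp mcoeff0 eqxx.
    + move=> v; rewrite IE mxE big_ord1 mxE mulr1; split; last first.
        by case=> w -> m; rewrite mulmx0 mxE mcoeff_msupp mcoeff0 eqxx.
      rewrite /pair_ideal => v0; exists 0; apply/rowP => k.
      rewrite mulmx0 mxE ord1; apply/msuppnil0; case: (msupp _) v0 => // m r /(_ m).
      by rewrite inE eqxx => /(_ isT).
    by move=> i v; split=> _; [exists 0|]; rewrite !thinmx0 ?mul0mx.
  - by move=> i k l; rewrite mxE mcoeff0.
  by move=> i; rewrite bin0n.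
have [F [resF minF rankF shiftF]] := IHs us (pair_ideal s) (fun=> iff_refl _).
exists (cone F 'X_[pair_mnm a] 2); split.
- apply: (cone_resolution (pair_ideal_ideal s)) resF.
  + by move=> p; rewrite IE; apply: pair_ideal_cons.
  + by move=> p; apply: pair_ideal_regular.
  by move=> m; rewrite msuppX inE => /eqP->; rewrite mdegD !mdeg1.
- apply: cone_minimal minF; rewrite mcoeffX -mdeg_eq0 mdegD !mdeg1 //.
- case=> [|i] /=; first by rewrite rankF !bin0.
  by rewrite !rankF binS.
case=> [|i] k /=; first exact: shiftF.
by case: split => b; rewrite shiftF // -PoszD mulnS addnC.
Qed.

Lemma betti_pair_ideal s (I : R -> Prop) i j : uniq s ->
  (forall p, I p <-> pair_ideal s p) ->
  betti I i j = if j == (2 * i)%:Z then 'C(size s, i) else 0%N.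
Proof.
move=> us IE; have [F [resF minF rankF shiftF]] := koszul_resolution us IE.
have idI : is_ideal I.
  have [I0 ID IM] := pair_ideal_ideal s.
  by split=> [|p q|p q]; rewrite !IE; [| apply: ID | apply: IM].
have homI : homogeneous I.
  by move=> z p; rewrite !IE; apply: pair_ideal_homogeneous.
rewrite (betti_eq idI homI i j resF minF).
case: eqP => [->|/eqP/negPf ji].
  by under eq_finset do rewrite shiftF eqxx; rewrite cardsT card_ord rankF.
by under eq_finset do rewrite shiftF eq_sym ji; rewrite cards0.
Qed.

End KoszulResolution.

(** * The matching number of a whiskered graph *)

Lemma edge_card (H : sgraph) e : e \in edges H -> #|e| = 2%N.
Proof.
case/imset2P => u v _; rewrite inE => /andP[_ uv] ->.
by rewrite cards2; case: eqP uv => // ->; rewrite adj_irrefl.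
Qed.

(** A matching covers twice as many vertices as it has edges, out of [2 * #|G|]; the whiskers attain
    the bound. *)
Lemma matching_number_whiskered (G : sgraph) :
  matching_number (whiskered G) = #|G|.
Proof.
apply/eqP; rewrite eqn_leq; apply/andP; split.
  apply/bigmax_leqP => M /andP[/subsetP ME /eqP tM].
  have := max_card (cover M); rewrite -tM card_sum.
  rewrite (eq_bigr (fun=> 2%N)) => [|e /ME/edge_card //].
  by rewrite sum_nat_const muln2 addnn leq_double.
pose e (a : G) : {set whiskered G} := [set inl a; inr a].
have e_inj : injective e.
  move=> a b /setP/(_ (inl a)); rewrite !inE eqxx /= orbF.
  by move/esym/eqP => [].
have eM : matching [set e a | a : G].
  apply/andP; split.
    apply/subsetP => _ /imsetP[a _ ->].
    by apply/imset2P; exists (inl a) (inr a); rewrite ?inE //=.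
  apply/trivIsetP => _ _ /imsetP[a _ ->] /imsetP[b _ ->] ab.
  rewrite -setI_eq0; apply/eqP/setP => -[] c; rewrite !inE /=.
    by apply: contraNF ab => /andP[]; rewrite !orbF => /eqP[->] /eqP[->].
  by apply: contraNF ab => /andP[/eqP[->] /eqP[->]].
by rewrite -(card_imset _ e_inj) (leq_bigmax_cond _ eM).
Qed.

(** * The closed neighborhood ideal of a whiskered graph *)

Section WhiskeredIdeal.

Variables (K : fieldType) (G : sgraph).
Local Notation H := (whiskered G).
Local Notation x := (fun a : G => enum_rank (inl a : H)).
Local Notation y := (fun a : G => enum_rank (inr a : H)).

Lemma nbhd_monomial_whisker a :
  nbhd_monomial K (inr a : H) = 'X_[pair_mnm x y a].
Proof.
rewrite /nbhd_monomial (_ : closed_nbhd _ = [set (inl a : H); (inr a : H)]).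
  by rewrite big_setU1 ?inE //= big_set1 mpolyXD.
by apply/setP => -[] b; rewrite !inE //= ?orbF // eq_sym.
Qed.

(* [N[x_a]] contains [N[y_a] = {x_a, y_a}], so only the whiskers matter. *)
Lemma nbhd_monomial_base a :
  exists c, nbhd_monomial K (inl a : H) = c * nbhd_monomial K (inr a : H).
Proof.
rewrite /nbhd_monomial; set A := closed_nbhd (inr a : H).
exists (\prod_(z in closed_nbhd (inl a : H) :\: A) 'X_(enum_rank z)).
have sA : A \subset closed_nbhd (inl a : H).
  apply/subsetP => -[] b; rewrite !inE /= ?orbF; first by move/eqP->; rewrite eqxx.
  by case/eqP => ->; rewrite eqxx.
by rewrite (big_setID A) /= (setIidPr sA) mulrC.
Qed.

Lemma NI_whiskered p : NI p <-> pair_ideal (K := K) x y (enum G) p.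
Proof.
have [I0 ID IM] := pair_ideal_ideal K x y (enum G).
split=> [[c ->]|Ip].
  have Iy a : pair_ideal x y (enum G) (nbhd_monomial K (inr a : H)).
    rewrite nbhd_monomial_whisker => m; rewrite msuppX inE => /eqP->.
    by apply/hasP; exists a; rewrite ?mem_enum ?lepm_refl.
  elim/big_ind: _ => // -[] a _; apply: (IM); last exact: Iy.
  by have [d ->] := nbhd_monomial_base a; apply: IM.
(* Conversely, [p] is the sum of its terms, and each is a multiple of one whisker generator. *)
rewrite [p]mpolyE big_seq; elim/big_ind: _.
- by exists (fun=> 0); rewrite big1 // => w _; rewrite mul0r.
- move=> q r [c ->] [d ->]; exists (fun w => c w + d w).
  by rewrite -big_split; apply: eq_bigr => w _; rewrite mulrDl.
move=> m /Ip /hasP[a _ am].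
exists (fun w => if w == inr a then p@_m *: 'X_[m - pair_mnm x y a] else 0).
rewrite (bigD1 (inr a)) //= eqxx big1 => [|w /negPf->]; last by rewrite mul0r.
by rewrite addr0 nbhd_monomial_whisker -scalerAl -mpolyXD submK.
Qed.

Lemma betti_NI_whiskered i j :
  betti (@NI K H) i j = if j == (2 * i)%:Z then 'C(#|G|, i) else 0%N.
Proof.
rewrite [in RHS]cardE; apply: betti_pair_ideal (enum_uniq _) NI_whiskered.
- by move=> a b /enum_rank_inj[].
- by move=> a b /enum_rank_inj[].
by move=> a b; rewrite (inj_eq enum_rank_inj).
Qed.

End WhiskeredIdeal.

Theorem proposition2p3 (K : fieldType) (G : sgraph) :
  is_regularity (@NI K (whiskered G)) (Posz (matching_number (whiskered G))) /\
  is_proj_dim (@NI K (whiskered G)) (matching_number (whiskered G)).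
Proof.
rewrite matching_number_whiskered; split; split.
(* The last Koszul module has rank 1 and shift [2 * #|G|], which gives [j - i = #|G|]. *)
- exists #|G|, (2 * #|G|)%:Z; rewrite betti_NI_whiskered eqxx binn; split=> //.
  lia.
- move=> _ [i [j [b_neq0 ->]]]; move: b_neq0; rewrite betti_NI_whiskered.
  (* A nonzero Betti number forces [j = 2i], hence [j - i = i], and [i] is at most [#|G|]. *)
  case: eqP => // ->; have [iG|iG] := leqP i #|G|; last by rewrite bin_small.
  lia.
- by exists (2 * #|G|)%:Z; rewrite betti_NI_whiskered eqxx binn.
move=> i [j]; rewrite betti_NI_whiskered; case: eqP => // _ /eqP.
by rewrite -lt0n bin_gt0.
Qed.
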